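(* Given a point $(\hat x,\hat y,\hat u)\in\mathbb{R}_+^{3T-1}$, there exists an $\mathcal{O}(T^3)$ time separation algorithm that finds the most violated inequality at $(\hat x,\hat y,\hat u)$, if any is violated, among the family of inequalities \begin{align*} x_t\le{}&\overline{V}y_t+V\sum_{i\in S_0}\Bigl(y_i-\sum_{j=0}^{\min\{L-1,i-2\}}u_{i-j}\Bigr)+V\sum_{i\in S\cup\{\hat t\}}(d_i-i)\Bigl(y_i-\sum_{j=0}^{L-1}u_{i-j}\Bigr)\\ &+(\overline{C}-\overline{V}-mV)\Bigl(y_{t+m+1}-\sum_{j=0}^{L-1}u_{t+m+1-j}\Bigr)+\phi(u,t) \end{align*} indexed by all $(t,m,S)$ with $t\in[1,T-1]_{\mathbb{Z}}$, $m$ an integer with $[\hat t-t-1]^+\le m\le\min\{T-t-1,(\overline{C}-\overline{V})/V\}$, and $S\subseteq[\hat t+1,t+m]_{\mathbb{Z}}$. Here $\hat t=t+\min\{t-2,L-2\}$ if $\min\{t-2,L-2\}\ge L/2$ and $\hat t=\max\{t+1,L+1\}$ otherwise, $S_0=[t+1,\hat t-1]_{\mathbb{Z}}$, $d_i=\min\{a\in S\cup\{t+m+1\}:a>i\}$ for $i\in S\cup\{\hat t\}$, and $\phi(u,t)=V\sum_{k=1}^{t+L-T-1}k\,u_{t-k}+V\sum_{k=[t+L-T]^+}^{\min\{L-1,t-2\}}\min\{L-1-k,k\}\,u_{t-k}$.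
   Context: $T$ (number of time periods) and $L$ (minimum-up time) are positive integers with $T\ge L+1$, and $\overline{C},\overline{V},V$ are real parameters (generation upper bound, start-up/shut-down ramp rate, ramp rate) with $\overline{V}\le\overline{C}$ and $V>0$. Vectors are $x=(x_1,\dots,x_T)$, $y=(y_1,\dots,y_T)$, $u=(u_2,\dots,u_T)$, so $(x,y,u)\in\mathbb{R}^{3T-1}$. For integers $a,b$, $[a,b]_{\mathbb{Z}}$ is the set of integers $i$ with $a\le i\le b$; $[a]^+=\max\{a,0\}$; empty sums are $0$. The violation of an inequality at a point is its left-hand side minus its right-hand side evaluated at the point; an inequality is violated if this is positive, and most violated means maximum violation over the family. In the running time bound, the number $(\overline{C}-\overline{V})/V$ (bounding $m$) is regarded as a constant, and the asymptotics are in $T$.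
   Formalization: When m equals t̂−t−1 (so t̂=t+m+1 and S is empty), d_i for i=t̂ is the minimum of an empty set and so undefined; it is taken to be t+m+1, which makes the coefficient d_i−i equal to 0. *)

(* Defs.v *)
(* MathComp world, with the reals given by an arbitrary realType. *)
From HB Require Import structures.
From mathcomp Require Import all_boot all_order all_algebra.
From mathcomp Require Import finmap reals.

Set Implicit Arguments.
Unset Strict Implicit.
Unset Printing Implicit Defensive.

Import Order.TTheory GRing.Theory Num.Theory.
Local Open Scope ring_scope.

(** * The family of inequalities

    All vectors keep the indices of the text: x_1 .. x_T, y_1 .. y_T and
    u_2 .. u_T.  The side conditions of [in_family] together with 0 < L < T
    ensure that no component outside these ranges is ever read, and that the
    truncated subtractions below are exact or give the same value. *)

(* The component of index [k] of a vector whose first index is [s]; the value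
   outside the index range is irrelevant. *)
Definition coord (R : realType) (s n : nat) (v : 'rV[R]_n) (k : nat) : R :=
  if (s <= k)%N then
    (if insub (k - s)%N is Some i then v ord0 i else 0)
  else 0.

(* The condition min{t-2, L-2} >= L/2 is cleared of its denominator; it is
   false both for negative minima and for their truncation to 0, as 0 < L. *)
Definition hat (L t : nat) : nat :=
  if (L <= 2 * minn (t - 2) (L - 2))%N then (t + minn (t - 2) (L - 2))%N
  else maxn t.+1 L.+1.

(* d_i = min {a in S U {e} : a > i}, where e = t + m + 1.  Since S lies below
   e, starting the minimum at e is the stated minimum whenever e > i.  The only
   other case is i = e = \hat t (then S is empty and the set is empty), where
   this gives d_i = i, that is, a coefficient d_i - i equal to 0: the ramping
   coefficients of the inequality still add up to m V. *)
Definition next (S : {fset nat}) (e i : nat) : nat :=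
  \big[minn/e]_(a <- S | (i < a)%N) a.

Definition phi (R : realType) (T L : nat) (V : R) (u : 'rV[R]_T.-1)
    (t : nat) : R :=
  V * (\sum_(1 <= k < t + L - T) k%:R * coord 2 u (t - k))
  + V * (\sum_(t + L - T <= k < minn L (t - 1))
           (minn (L - 1 - k) k)%:R * coord 2 u (t - k)).

Definition rhs (R : realType) (T L : nat) (C Vbar V : R)
    (y : 'rV[R]_T) (u : 'rV[R]_T.-1) (t m : nat) (S : {fset nat}) : R :=
  let e := (t + m + 1)%N in
  Vbar * coord 1 y t
  + V * (\sum_(t.+1 <= i < hat L t)
           (coord 1 y i - \sum_(0 <= j < minn L (i - 1)) coord 2 u (i - j)))
  + V * (\sum_(i <- (hat L t |` S)%fset)
           ((next S e i)%:R - i%:R)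
           * (coord 1 y i - \sum_(0 <= j < L) coord 2 u (i - j)))
  + (C - Vbar - m%:R * V)
    * (coord 1 y e - \sum_(0 <= j < L) coord 2 u (e - j))
  + phi L V u t.

Definition violation (R : realType) (T L : nat) (C Vbar V : R)
    (x y : 'rV[R]_T) (u : 'rV[R]_T.-1) (t m : nat) (S : {fset nat}) : R :=
  coord 1 x t - rhs L C Vbar V y u t m S.

Definition in_family (R : realType) (T L : nat) (C Vbar V : R)
    (t m : nat) (S : {fset nat}) : Prop :=
  [/\ (1 <= t <= T - 1)%N,
      (hat L t - t - 1 <= m <= T - t - 1)%N,
      m%:R <= (C - Vbar) / V
    & forall i, i \in S -> (hat L t + 1 <= i <= t + m)%N].

(** * Algorithms: programs of a unit-cost real RAM

    A program is a finite piece of syntax, independent of the input.  It works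
    on finitely many arrays of natural numbers and arrays of real numbers (a
    scalar variable being a cell of an array), array indices being computed
    from natural numbers only.  The primitive operations are addition and
    truncated subtraction of naturals, the four field operations on reals, and
    comparisons.  Natural and real numbers cannot be converted into each other,
    there is no rounding operation, and the only real constants are the natural
    numbers written in the program. *)

Inductive nexp : Type :=
  | NConst of nat
  | NGet of nat & nexp
  | NAdd of nexp & nexp
  | NSub of nexp & nexp.

Inductive rexp : Type :=
  | RConst of nat
  | RGet of nat & nexp
  | RAdd of rexp & rexp
  | RSub of rexp & rexp
  | RMul of rexp & rexp
  | RDiv of rexp & rexp.

Inductive bexp : Type :=
  | NLe of nexp & nexp
  | RLe of rexp & rexp
  | BNot of bexp
  | BAnd of bexp & bexp.

Inductive cmd : Type :=
  | Skip
  | NSet of nat & nexp & nexp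
  | RSet of nat & nexp & rexp
  | Seq of cmd & cmd
  | If of bexp & cmd & cmd
  | While of bexp & cmd.

(* [nmem s a i] and [rmem s a i] are the cells of index [i] of the natural,
   resp. real, array named [a]. *)
Record state (R : realType) : Type := State {
  nmem : nat -> nat -> nat;
  rmem : nat -> nat -> R }.

Definition upd (A : Type) (M : nat -> nat -> A) (a i : nat) (v : A) :
    nat -> nat -> A :=
  fun b j => if (b == a) && (j == i) then v else M b j.

Fixpoint neval (R : realType) (s : state R) (e : nexp) : nat :=
  match e with
  | NConst k => k
  | NGet a i => nmem s a (neval s i)
  | NAdd e1 e2 => (neval s e1 + neval s e2)%N
  | NSub e1 e2 => (neval s e1 - neval s e2)%N
  end.

Fixpoint reval (R : realType) (s : state R) (e : rexp) : R :=
  match e with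
  | RConst k => k%:R
  | RGet a i => rmem s a (neval s i)
  | RAdd e1 e2 => reval s e1 + reval s e2
  | RSub e1 e2 => reval s e1 - reval s e2
  | RMul e1 e2 => reval s e1 * reval s e2
  | RDiv e1 e2 => reval s e1 / reval s e2
  end.

Fixpoint beval (R : realType) (s : state R) (b : bexp) : bool :=
  match b with
  | NLe e1 e2 => (neval s e1 <= neval s e2)%N
  | RLe e1 e2 => reval s e1 <= reval s e2
  | BNot b1 => ~~ beval s b1
  | BAnd b1 b2 => beval s b1 && beval s b2
  end.

(* Evaluating an expression takes one time unit per constant, memory access,
   operation or comparison occurring in it. *)
Fixpoint ncost (e : nexp) : nat :=
  match e with
  | NConst _ => 1
  | NGet _ i => (ncost i).+1
  | NAdd e1 e2 | NSub e1 e2 => (ncost e1 + ncost e2).+1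
  end.

Fixpoint rcost (e : rexp) : nat :=
  match e with
  | RConst _ => 1
  | RGet _ i => (ncost i).+1
  | RAdd e1 e2 | RSub e1 e2 | RMul e1 e2 | RDiv e1 e2 =>
      (rcost e1 + rcost e2).+1
  end.

Fixpoint bcost (b : bexp) : nat :=
  match b with
  | NLe e1 e2 => (ncost e1 + ncost e2).+1
  | RLe e1 e2 => (rcost e1 + rcost e2).+1
  | BNot b1 => (bcost b1).+1
  | BAnd b1 b2 => (bcost b1 + bcost b2).+1
  end.

(* [exec p s n s']: started in state [s], the program [p] terminates in state
   [s'] after exactly [n] time units. *)
Inductive exec (R : realType) : cmd -> state R -> nat -> state R -> Prop :=
  | ExecSkip s :
      exec Skip s 1 s
  | ExecNSet a i e s :
      exec (NSet a i e) s (ncost i + ncost e).+1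
        (State (upd (nmem s) a (neval s i) (neval s e)) (rmem s))
  | ExecRSet a i e s :
      exec (RSet a i e) s (ncost i + rcost e).+1
        (State (nmem s) (upd (rmem s) a (neval s i) (reval s e)))
  | ExecSeq p1 p2 s n1 s1 n2 s2 :
      exec p1 s n1 s1 -> exec p2 s1 n2 s2 ->
      exec (Seq p1 p2) s (n1 + n2)%N s2
  | ExecIfTrue b p1 p2 s n s' :
      beval s b -> exec p1 s n s' ->
      exec (If b p1 p2) s (bcost b + n).+1 s'
  | ExecIfFalse b p1 p2 s n s' :
      ~~ beval s b -> exec p2 s n s' ->
      exec (If b p1 p2) s (bcost b + n).+1 s'
  | ExecWhileFalse b p s :
      ~~ beval s b ->
      exec (While b p) s (bcost b).+1 s
  | ExecWhileTrue b p s n1 s1 n2 s2 :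
      beval s b -> exec p s n1 s1 -> exec (While b p) s1 n2 s2 ->
      exec (While b p) s (bcost b + n1 + n2).+1 s2.

(** * The separation problem: input and output conventions *)

(* Natural array 0 holds T, L; real array 0 holds C, Vbar, V; real arrays 1, 2
   and 3 hold x, y and u, at their own indices; all other cells are 0. *)
Definition input (R : realType) (T L : nat) (C Vbar V : R)
    (x y : 'rV[R]_T) (u : 'rV[R]_T.-1) : state R :=
  State
    (fun a i => if a is 0 then nth 0%N [:: T; L] i else 0%N)
    (fun a i => match a with
                | 0 => nth 0 [:: C; Vbar; V] i
                | 1 => coord 1 x i
                | 2 => coord 1 y i
                | 3 => coord 2 u i
                | _ => 0
                end).

(* Natural array 1 holds, in this order, a flag telling whether some inequality
   is violated, t and m; natural array 2 holds the characteristic vector of S. *)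
Definition out_flag (R : realType) (s : state R) : nat := nmem s 1 0.
Definition out_t (R : realType) (s : state R) : nat := nmem s 1 1.
Definition out_m (R : realType) (s : state R) : nat := nmem s 1 2.
Definition out_S (R : realType) (T : nat) (s : state R) : {fset nat} :=
  [fset i in iota 1 T | nmem s 2 i == 1%N]%fset.

Definition separated (R : realType) (T L : nat) (C Vbar V : R)
    (x y : 'rV[R]_T) (u : 'rV[R]_T.-1) (s : state R) : Prop :=
  let viol := violation L C Vbar V x y u in
  let fam := in_family T L C Vbar V in
  let t := out_t s in let m := out_m s in let S := out_S T s in
  (out_flag s = 0%N /\ forall t' m' S', fam t' m' S' -> viol t' m' S' <= 0)
  \/
  [/\ out_flag s = 1%N, fam t m S, 0 < viol t m S
    & forall t' m' S', fam t' m' S' -> viol t' m' S' <= viol t m S].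

(* Main.v *)
(** Write [net i = y_i - sum_(j < L) u_(i-j)].  The coefficients [d_i - i] of the
    third term count the periods [k] from [\hat t] to [t + m] whose last
    predecessor in [S U {\hat t}] is [i], so that term is the sum over these [k]
    of [net (i_k)] with [\hat t <= i_k <= k].  It is therefore at least the sum of
    the running minima of [net] from [\hat t] on, and it attains this bound when
    [S] consists of the periods at which the running minimum strictly decreases.
    Hence the best [S] for a given [(t, m)] is found in one linear scan, and
    enumerating the O(T^2) pairs [(t, m)] gives the cubic algorithm. *)

From mathcomp Require Import all_boot all_order all_algebra.
From mathcomp Require Import finmap reals zify.
(* Loaded last, so that [next] is the one of the family of inequalities and not
   [path.next]. *)
Require Import Defs.
Import Order.TTheory GRing.Theory Num.Theory.
Local Open Scope ring_scope.
Set Implicit Arguments.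
Unset Strict Implicit.
Unset Printing Implicit Defensive.

(** * The optimal set S *)

(** The window from [h] to [k] corresponds to [n = k.+1 - h]. The value [w h] at [n = 0] stands in
    for an infinite one, so that a strict record is never found at [h] itself. *)
Fixpoint run_min (R : realType) (w : nat -> R) (h n : nat) : R :=
  if n is n'.+1 then Num.min (run_min w h n') (w (h + n')%N) else w h.

Lemma run_min_le (R : realType) (w : nat -> R) h k i :
  (h <= i <= k)%N -> run_min w h (k.+1 - h) <= w i.
Proof.
move=> /andP[hi ik]; rewrite subSn ?(leq_trans hi) //.
have -> : i = (h + (i - h))%N by lia.
have : (i - h <= k - h)%N by lia.
elim: (k - h)%N => [|n IHn] /= ih.
  by move: ih; rewrite leqn0 => /eqP ->; rewrite addn0 minxx.
rewrite [X in Num.min X _](_ : _ = run_min w h n.+1) // ge_min.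
by case: (leqP (i - h)%N n) => [/IHn ->//|lt]; rewrite (_ : _ - _ = n.+1)%N ?lexx ?orbT //; lia.
Qed.

Lemma next_le S e i : (next S e i <= e)%N.
Proof. by rewrite /next; elim/big_rec: _ => // a n _ ne; rewrite geq_min ne orbT. Qed.

Lemma next_le_mem (S : {fset nat}) e i a :
  a \in S -> (i < a)%N -> (next S e i <= a)%N.
Proof.
rewrite /next => aS ia; elim: (enum_fset S) (aS : a \in enum_fset S) => // b s IHs.
rewrite inE big_cons => /orP[/eqP <-|/IHs le].
  by rewrite ia geq_min leqnn.
by case: ifP => // _; rewrite geq_min le orbT.
Qed.

Lemma next_gt S e i : (i < e)%N -> (i < next S e i)%N.
Proof. by move=> ie; rewrite /next; elim/big_ind: _ => // a b ia ib; rewrite leq_min ia. Qed.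

Lemma next_ge S e i : (i <= e)%N -> (i <= next S e i)%N.
Proof.
move=> ie; rewrite /next; elim/big_ind: _ => [//|a b ia ib|a /ltnW //].
by rewrite leq_min ia.
Qed.

Lemma next_mem (S : {fset nat}) e i : next S e i != e -> next S e i \in S.
Proof.
suff [->|//] : next S e i = e \/ next S e i \in S by rewrite eqxx.
rewrite /next big_seq_cond; elim/big_ind: _ => [|a b Ha Hb|a /andP[aS _]]; try by [left|right].
by rewrite /minn; case: ifP.
Qed.

Section Ramping.

Variables (R : realType) (w : nat -> R) (h e : nat) (S : {fset nat}).
Hypotheses (he : (h <= e)%N) (Sin : forall i, i \in S -> (h < i < e)%N).

(** The coefficient of [w i] counts the periods [k] with [i <= k < next S e i], all of them between
    [h] and [e]; it is expanded over these periods and the two sums are swapped. *)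
Lemma ramp_sum_exchange :
  \sum_(i <- (h |` S)%fset) ((next S e i)%:R - i%:R) * w i =
  \sum_(h <= k < e) \sum_(i <- (h |` S)%fset | (i <= k < next S e i)%N) w i.
Proof.
rewrite (exchange_big_dep xpredT) //= big_seq [RHS]big_seq.
apply: eq_bigr => i; rewrite !inE => iS.
have /andP[hi ie] : (h <= i <= e)%N.
  by case/orP: iS => [/eqP ->|/Sin]; lia.
rewrite -natrB ?next_ge // mulr_natl -sumr_const_nat.
rewrite (big_nat_widen _ _ _ _ _ (next_le S e i)) (big_nat_widenl _ h) //.
by apply: eq_bigl => k; rewrite andbC.
Qed.

(** Induction on [k]: either [k.+1] belongs to the set, or the element covering [k] also covers
    [k.+1], since its successor could be [k.+1] only if [k.+1] were in [S]. *)
Lemma ramp_pred k : (h <= k < e)%N ->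
  exists2 i, i \in (h |` S)%fset & (i <= k < next S e i)%N.
Proof.
elim: k => [|k IHk] /andP[hk ke].
  exists h; first by rewrite !inE eqxx.
  by have := @next_gt S e h; lia.
have [->|nh] := eqVneq h k.+1.
  by exists k.+1; rewrite ?inE ?eqxx // leqnn next_gt.
have [kS|kS] := boolP (k.+1 \in S).
  by exists k.+1; rewrite ?inE ?kS ?orbT // leqnn next_gt.
have [|i iS /andP[ik kn]] := IHk; first by lia.
exists i => //; rewrite leqW //= ltn_neqAle kn andbT.
apply: contraNneq kS => kE; rewrite kE next_mem // -kE; lia.
Qed.

(** If [i < j], then [j] is in [S], hence [next S e i <= j]: the two intervals are disjoint. *)
Lemma ramp_pred_uniq k i j :
  i \in (h |` S)%fset -> j \in (h |` S)%fset ->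
  (i <= k < next S e i)%N -> (j <= k < next S e j)%N -> i = j.
Proof.
wlog: i j / (i < j)%N.
  by move=> W iS jS ik jk; case: (ltngtP i j) => // ?; [apply: W|apply/esym/W].
rewrite !inE => ij iS jS /andP[_ kn] /andP[jk _].
have jS' : j \in S.
  by case/orP: jS => // /eqP jh; case/orP: iS => [/eqP|/Sin]; lia.
have := next_le_mem e jS' ij; lia.
Qed.

Lemma ramp_inner k i :
  i \in (h |` S)%fset -> (i <= k < next S e i)%N ->
  \sum_(j <- (h |` S)%fset | (j <= k < next S e j)%N) w j = w i.
Proof.
move=> iS ik; rewrite big_mkcond (bigD1_seq i) //= ik big_seq_cond big1 ?addr0 //.
move=> j /andP[jS ji]; case: ifP => // jk.
by rewrite (ramp_pred_uniq jS iS jk ik) eqxx in ji.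
Qed.

Lemma ramp_sum_ge :
  \sum_(h <= k < e) run_min w h (k.+1 - h)
  <= \sum_(i <- (h |` S)%fset) ((next S e i)%:R - i%:R) * w i.
Proof.
rewrite ramp_sum_exchange; apply: ler_sum_nat => k hk.
have [i iS ik] := ramp_pred hk.
rewrite (ramp_inner iS ik) run_min_le //.
have : (h <= i)%N by move: iS; rewrite !inE => /orP[/eqP->//|/Sin]; lia.
lia.
Qed.

(** The equality holds period by period. A period in [S] is a strict record and becomes the new
    minimum; a period outside [S] leaves both the minimum and the covering element unchanged. *)
Lemma ramp_sum_records :
  (forall k, (h < k < e)%N -> (k \in S) = (w k < run_min w h (k - h))) ->
  \sum_(i <- (h |` S)%fset) ((next S e i)%:R - i%:R) * w i
  = \sum_(h <= k < e) run_min w h (k.+1 - h).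
Proof.
move=> rec; rewrite ramp_sum_exchange; apply: eq_big_nat => k /andP[hk ke].
have [|i iS ik] := @ramp_pred k; first by rewrite hk.
rewrite (ramp_inner iS ik); case/andP: ik => ik kn.
have stepE j : (h <= j)%N -> run_min w h (j.+1 - h) = Num.min (run_min w h (j - h)) (w j).
  by move=> hj; rewrite subSn //= subnKC.
have hi : (h <= i)%N by move: iS; rewrite !inE => /orP[/eqP->//|/Sin]; lia.
(* The bounds on [k] follow from [i <= k < next S e i], so they are dropped before the induction,
   which starts at 0 and not at [h]. *)
elim: k ik kn {hk ke} => [|k IHk] ik kn.
  have [-> ->] : i = 0%N /\ h = 0%N by lia.
  by rewrite /= minxx.
have [ik1|ik1] := eqVneq i k.+1.
  rewrite ik1 in iS hi *; move: iS; rewrite !inE => /orP[/eqP <-|kS].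
    by rewrite subSn // subnn /= addn0 minxx.
  rewrite stepE //; have := Sin kS; have := kS; rewrite rec; last exact: Sin.
  by move=> lt _; rewrite (min_idPr _) // ltW.
rewrite stepE; last lia.
rewrite -IHk; [|lia|lia].
have := rec k.+1; have /negbTE -> : k.+1 \notin S.
  by apply/negP => kS; have := @next_le_mem S e i _ kS; lia.
have -> : (h < k.+1 < e)%N by have := next_le S e i; lia.
move=> /(_ isT) /esym /negbT; rewrite -leNgt -IHk; [|lia|lia].
by move=> ?; rewrite (min_idPl _).
Qed.

End Ramping.

(** * Total correctness with running time *)

Fixpoint nwrites (p : cmd) : seq nat :=
  match p with
  | Skip | RSet _ _ _ => [::]
  | NSet a _ _ => [:: a]
  | Seq p q | If _ p q => nwrites p ++ nwrites q
  | While _ p => nwrites p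
  end.

Fixpoint rwrites (p : cmd) : seq nat :=
  match p with
  | Skip | NSet _ _ _ => [::]
  | RSet a _ _ => [:: a]
  | Seq p q | If _ p q => rwrites p ++ rwrites q
  | While _ p => rwrites p
  end.

Fixpoint depth (p : cmd) : nat :=
  match p with
  | Skip | NSet _ _ _ | RSet _ _ _ => 0
  | Seq p q | If _ p q => maxn (depth p) (depth q)
  | While _ p => (depth p).+1
  end.

(** Cost of the text with each loop body counted once. Both branches of a conditional are charged,
    an overestimate that makes the bound independent of the state. *)
Fixpoint weight (p : cmd) : nat :=
  match p with
  | Skip => 1
  | NSet _ i e => (ncost i + ncost e).+1
  | RSet _ i e => (ncost i + rcost e).+1
  | Seq p q => weight p + weight q
  | If b p q => (bcost b + (weight p + weight q)).+1
  | While b p => (bcost b + weight p).+1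
  end.

(** Frame condition by whole arrays: what a program preserves can then be read off its text, without
    reasoning on indices. *)
Definition agree (R : realType) (ns rs : seq nat) (s s' : state R) : Prop :=
  (forall a, a \notin ns -> nmem s' a =1 nmem s a) /\
  (forall a, a \notin rs -> rmem s' a =1 rmem s a).

Lemma agree_refl (R : realType) ns rs (s : state R) : agree ns rs s s.
Proof. by []. Qed.

Lemma agree_trans (R : realType) ns rs (s1 s2 s3 : state R) :
  agree ns rs s1 s2 -> agree ns rs s2 s3 -> agree ns rs s1 s3.
Proof.
move=> [n12 r12] [n23 r23]; split=> a ha i.
  by rewrite n23 ?n12.
by rewrite r23 ?r12.
Qed.

Lemma agree_sub (R : realType) (ns rs ns' rs' : seq nat) (s s' : state R) :
  {subset ns <= ns'} -> {subset rs <= rs'} ->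
  agree ns rs s s' -> agree ns' rs' s s'.
Proof.
move=> sn sr [n r]; split=> a ha.
  by apply: n; apply: contra ha; apply: sn.
by apply: r; apply: contra ha; apply: sr.
Qed.

(* The bound on the running time is a function of the program text alone: it holds
   as soon as each execution of a loop makes at most [N] iterations. *)
Definition runs (R : realType) (N : nat) (p : cmd) (s : state R)
    (Q : state R -> Prop) : Prop :=
  exists n s', [/\ exec p s n s', (n <= weight p * N.+1 ^ depth p)%N & Q s'].

Lemma exec_agree (R : realType) p (s : state R) n s' :
  exec p s n s' -> agree (nwrites p) (rwrites p) s s'.
Proof.
elim=> {p s n s'} //=.
- move=> a i e s; split=> //= b; rewrite inE => /negbTE ab j.
  by rewrite /upd ab.
- move=> a i e s; split=> //= b; rewrite inE => /negbTE ab j.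
  by rewrite /upd ab.
- move=> p1 p2 s n1 s1 n2 s2 _ A1 _ A2.
  by apply: agree_trans (agree_sub _ _ A1) (agree_sub _ _ A2) => a;
    rewrite mem_cat => ->; rewrite ?orbT.
- by move=> b p1 p2 s n s' _ _; apply: agree_sub => a; rewrite mem_cat => ->.
- by move=> b p1 p2 s n s' _ _; apply: agree_sub => a; rewrite mem_cat orbC => ->.
- by move=> b p s n1 s1 n2 s2 _ _ A1 _ A2; apply: agree_trans A1 A2.
Qed.

Section Rules.

Variables (R : realType) (N : nat).
Implicit Types (s : state R) (p : cmd) (Q : state R -> Prop).

(** Makes the frame condition of the whole program available when its postcondition is proved. *)
Lemma runs_agree p s Q :
  runs N p s (fun s' => agree (nwrites p) (rwrites p) s s' -> Q s') ->
  runs N p s Q.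
Proof.
move=> [n [s' [e b q]]]; exists n, s'; split=> //; apply: q.
exact: exec_agree e.
Qed.

Lemma runs_cons p s Q Q' :
  runs N p s Q -> (forall s', Q s' -> Q' s') -> runs N p s Q'.
Proof. by move=> [n [s' [e b q]]] QQ'; exists n, s'; split=> //; apply: QQ'. Qed.

Lemma runs_skip s Q : Q s -> runs N Skip s Q.
Proof. by move=> q; exists 1%N, s; split=> //; constructor. Qed.

Lemma runs_nset a i e s Q :
  Q (State (upd (nmem s) a (neval s i) (neval s e)) (rmem s)) ->
  runs N (NSet a i e) s Q.
Proof.
move=> q; eexists; eexists; split; [exact: ExecNSet| |exact: q].
by rewrite expn0 muln1.
Qed.

Lemma runs_rset a i e s Q :
  Q (State (nmem s) (upd (rmem s) a (neval s i) (reval s e))) ->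
  runs N (RSet a i e) s Q.
Proof.
move=> q; eexists; eexists; split; [exact: ExecRSet| |exact: q].
by rewrite expn0 muln1.
Qed.

Lemma runs_seq p q s Q :
  runs N p s (fun s' => runs N q s' Q) -> runs N (Seq p q) s Q.
Proof.
move=> [n [s' [e b [n' [s'' [e' b' HQ]]]]]].
exists (n + n')%N, s''; split=> //; first exact: ExecSeq e e'.
rewrite /= mulnDl leq_add // ?(leq_trans b) ?(leq_trans b') //
  leq_mul2l leq_pexp2l ?orbT // leq_max leqnn ?orbT //.
Qed.

Lemma runs_if b p q s Q :
  (beval s b -> runs N p s Q) -> (~~ beval s b -> runs N q s Q) ->
  runs N (If b p q) s Q.
Proof.
case: (boolP (beval s b)) => hb Hp Hq.
  have [//|n [s' [e B HQ]]] := Hp; exists (bcost b + n).+1, s'; split=> //.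
    exact: ExecIfTrue.
  rewrite /= -[(_ + n).+1]addSn -[(_ + (_ + _)).+1]addSn mulnDl leq_add ?leq_pmulr ?expn_gt0 //.
  apply: leq_trans B _; apply: leq_mul; first exact: leq_addr.
  by rewrite leq_pexp2l // leq_maxl.
have [//|n [s' [e B HQ]]] := Hq; exists (bcost b + n).+1, s'; split=> //.
  exact: ExecIfFalse.
rewrite /= -[(_ + n).+1]addSn -[(_ + (_ + _)).+1]addSn mulnDl leq_add ?leq_pmulr ?expn_gt0 //.
apply: leq_trans B _; apply: leq_mul; first exact: leq_addl.
by rewrite leq_pexp2l // leq_maxr.
Qed.

(** The index of [I] is the number of iterations still to come. With [n] iterations there are [n.+1]
    tests and [n] bodies, and both counts are at most [N.+1], the factor gained by one more level of
    [depth]. *)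
Lemma runs_while b p (I : nat -> state R -> Prop) n s Q :
  (n <= N)%N -> I n s ->
  (forall k s, I k s -> beval s b = (0 < k)%N) ->
  (forall k s, I k.+1 s -> runs N p s (I k)) ->
  (forall s, I 0%N s -> Q s) ->
  runs N (While b p) s Q.
Proof.
move=> nN In guard body HQ.
suff [m [s' [e B Is']]] : exists m s', [/\ exec (While b p) s m s',
    (m <= n.+1 * (bcost b).+1 + n * (weight p * N.+1 ^ depth p))%N & I 0%N s'].
  exists m, s'; split=> //; last exact: HQ.
  apply: leq_trans B _; rewrite [weight (While _ _)]/= [depth (While _ _)]/=.
  rewrite expnSr -[(_ + weight p).+1]/((bcost b).+1 + weight p)%N mulnDl.
  rewrite [X in (_ <= X + _)%N]mulnA [X in (_ <= _ + X)%N]mulnA leq_add //.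
    by rewrite mulnC; apply: leq_mul => //; rewrite leq_pmulr ?expn_gt0.
  by rewrite [leqRHS]mulnC; apply: leq_mul => //; exact: leqW.
elim: n s In {nN} => [|n IHn] s In.
  exists (bcost b).+1, s; split=> //; last by rewrite mul0n addn0 mul1n.
  by apply: ExecWhileFalse; rewrite (guard _ _ In).
have [n1 [s1 [e1 B1 /IHn [n2 [s2 [e2 B2 I2]]]]]] := body _ _ In.
exists (bcost b + n1 + n2).+1, s2; split=> //.
  by apply: ExecWhileTrue e1 e2; rewrite (guard _ _ In).
move: B1 B2; rewrite [(n.+2 * _)%N]mulSn [(n.+1 * (weight p * _))%N]mulSn.
lia.
Qed.

End Rules.

(** * Counted loops and sums *)

Definition cell (a : nat) : nexp := NGet a (NConst 0).
Definition rcell (a : nat) : rexp := RGet a (NConst 0).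

(** The bound [hi] is exclusive and is evaluated anew at each test, so the rule below asks that its
    value be stable under the frame condition. *)
Definition For (j : nat) (lo hi : nexp) (p : cmd) : cmd :=
  Seq (NSet j (NConst 0) lo)
    (While (NLe (NAdd (cell j) (NConst 1)) hi)
       (Seq p (NSet j (NConst 0) (NAdd (cell j) (NConst 1))))).

Definition setc (R : realType) (s : state R) (j v : nat) : state R :=
  State (upd (nmem s) j 0%N v) (rmem s).

(** [I k] holds before iteration [k]; it must ignore the counter, which changes between two
    iterations. The final index [maxn l h] also covers the empty range [h <= l]. *)
Lemma runs_for (R : realType) N j lo hi p (s : state R)
    (I : nat -> state R -> Prop) l h Q :
  let F := agree (nwrites (For j lo hi p)) (rwrites p) s in
  j \notin nwrites p ->
  neval s lo = l -> (forall s', F s' -> neval s' hi = h) ->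
  (h - l <= N)%N ->
  (forall k s' v, I k s' -> I k (setc s' j v)) ->
  I l s ->
  (forall k s', F s' -> (l <= k < h)%N -> nmem s' j 0%N = k -> I k s' ->
     runs N p s' (I k.+1)) ->
  (forall s', F s' -> I (maxn l h) s' -> Q s') ->
  runs N (For j lo hi p) s Q.
Proof.
move=> F jp loE hiE hlN Iset Il body HQ.
have Fset s' v : F s' -> F (setc s' j v).
  move=> Fs; apply: agree_trans Fs _; split=> //= a.
  by rewrite inE negb_or /upd => /andP[/negbTE ->].
apply: runs_seq; apply: runs_nset; rewrite loE -/(setc s j l).
(* Conversion from remaining iterations [r] to the current index: [r = h - l] gives [l], and [r = 0]
   gives [maxn l h]. *)
pose J r (s' : state R) := let k := (maxn l h - r)%N in
  [/\ F s', (r <= h - l)%N, nmem s' j 0%N = k & I k s'].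
apply: (@runs_while _ _ _ _ J (h - l)) => //.
- split=> //; first exact/Fset/agree_refl.
    by rewrite /= /upd !eqxx /=; lia.
  by rewrite (_ : _ - _ = l)%N; [exact: Iset | lia].
- move=> r s' [Fs rl jE _] /=; rewrite hiE // jE; lia.
- move=> r s' [Fs rl jE Ik]; apply: runs_seq; apply: runs_agree.
  have := body _ s' Fs _ jE Ik.
  move=> /(_ _)/runs_cons; apply; first lia.
  move=> s1 I1 A1; apply: runs_nset.
  rewrite [neval _ _]/= [neval _ (NAdd _ _)]/=.
  rewrite (A1.1 _ jp) jE -/(setc s1 j _).
  have kE : (maxn l h - r.+1 + 1 = maxn l h - r)%N by lia.
  split; last 1 first.
  + by rewrite -kE addn1; apply: Iset.
  + apply: Fset; apply: agree_trans Fs _; apply: agree_sub A1 => // a.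
    by rewrite /= inE mem_cat => ->; rewrite orbT.
  + lia.
  + by rewrite /= /upd !eqxx kE.
- by move=> s' [Fs _ _]; rewrite subn0; apply: HQ.
Qed.

(* [r := \sum_(lo <= k < hi) e], where [e] reads [k] in the natural array 3. *)
Definition Sum (r : nat) (lo hi : nexp) (e : rexp) : cmd :=
  Seq (RSet r (NConst 0) (RConst 0))
    (For 3 lo hi (RSet r (NConst 0) (RAdd (rcell r) e))).

Lemma runs_sum (R : realType) N r lo hi e (s : state R) l h (f : nat -> R) Q :
  let F := agree [:: 3%N] [:: r] s in
  (forall s', F s' -> neval s' lo = l /\ neval s' hi = h) ->
  (h - l <= N)%N ->
  (forall k s', F s' -> nmem s' 3 0%N = k -> (l <= k < h)%N ->
     reval s' e = f k) ->
  (forall s', F s' -> rmem s' r 0%N = \sum_(l <= k < h) f k -> Q s') ->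
  runs N (Sum r lo hi e) s Q.
Proof.
move=> F bE hlN eE HQ.
apply: runs_seq; apply: runs_rset; set s0 := State _ _.
have F0 : F s0 by split=> //= a; rewrite inE => /negbTE ar i; rewrite /upd ar.
have FF s' : agree [:: 3%N; 3%N] [:: r] s0 s' -> F s'.
  by move=> A; apply: agree_trans F0 (agree_sub _ _ A) => // a; rewrite !inE orbb.
apply: (@runs_for _ _ _ _ _ _ _
  (fun k s' => rmem s' r 0%N = \sum_(l <= i < k) f i) l h) => //.
- by have [] := bE _ F0.
- by move=> s' A; have [] := bE _ (FF _ A).
- by rewrite big_geq //= /upd !eqxx.
- move=> k s' A; have Fs := FF _ A; move=> /[dup] /andP[lk kh] lkh jE sE; apply: runs_rset => /=.
  by rewrite /upd !eqxx /= sE (eE _ _ Fs jE lkh) big_nat_recr.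
- move=> s' A sE; have Fs := FF _ A; apply: HQ => //; rewrite sE.
  by case: (leqP l h) => // hl; rewrite !big_geq // ltnW.
Qed.

(** * The algorithm *)

(** Under truncated subtraction, [a - (a - b)] is the minimum of [a] and [b]. *)
Definition NMin (a b : nexp) : nexp := NSub a (NSub a b).

(* Natural arrays: 3 summation index, 4 and 5 current [t] and [m], 6 table and scan
   index, 7 table of [\hat t].  Real arrays: 4 table of the naturals, standing in for
   the missing conversion, 5 and 6 tables of the summands of the second and third
   terms of the inequality, 7 and 11-14 sums, 8 largest violation so far, 9 running
   minimum, 10 current violation. *)
Local Notation "'N0'" := (NConst 0).
Local Notation "'N1'" := (NConst 1).
Local Notation "'aT'" := (NGet 0 N0).
Local Notation "'aL'" := (NGet 0 N1).
Local Notation "'aC'" := (RGet 0 N0).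
Local Notation "'aVbar'" := (RGet 0 N1).
Local Notation "'aV'" := (RGet 0 (NConst 2)).
Local Notation "'ctr'" := (cell 3).
Local Notation "'at_'" := (cell 4).
Local Notation "'am'" := (cell 5).
Local Notation "'idx'" := (cell 6).

Definition number_table : cmd :=
  Seq (RSet 4 N0 (RConst 0))
      (For 6 N1 (NAdd aT N1)
        (RSet 4 idx (RAdd (RGet 4 (NSub idx N1)) (RConst 1)))).

Definition net_table (a : nat) (len : nexp) : cmd :=
  For 6 N1 (NAdd aT N1)
    (Seq (Sum 7 N0 len (RGet 3 (NSub idx ctr)))
         (RSet a idx (RSub (RGet 2 idx) (rcell 7)))).

(** Doubling is written [q + q], and the maximum of [a] and [b] as [a + (b - a)] with truncated
    subtraction. *)
Definition hat_table : cmd :=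
  let q := NMin (NSub idx (NConst 2)) (NSub aL (NConst 2)) in
  For 6 N1 (NAdd aT N1)
    (If (NLe aL (NAdd q q)) (NSet 7 idx (NAdd idx q))
        (NSet 7 idx (NAdd (NAdd idx N1) (NSub (NAdd aL N1) (NAdd idx N1))))).

Definition tables : cmd :=
  Seq number_table
 (Seq (net_table 5 (NMin aL (NSub idx N1)))
 (Seq (net_table 6 aL) hat_table)).

Definition ahat : nexp := NGet 7 at_.
Definition ae : nexp := NAdd (NAdd at_ am) N1.

(** The running minimum starts at the first period visited, which therefore passes the non-strict
    test and is marked 0: [\hat t] stays out of [S]. *)
Definition scan : cmd :=
  Seq (RSet 9 N0 (RGet 6 ahat))
 (Seq (RSet 12 N0 (RConst 0))
      (For 6 ahat ae
        (Seq (If (RLe (rcell 9) (RGet 6 idx))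
                 (NSet 2 idx N0)
                 (Seq (RSet 9 N0 (RGet 6 idx)) (NSet 2 idx N1)))
             (RSet 12 N0 (RAdd (rcell 12) (rcell 9)))))).

Definition evaluate : cmd :=
  Seq (Sum 11 (NAdd at_ N1) ahat (RGet 5 ctr))
 (Seq scan
 (Seq (Sum 13 N1 (NSub (NAdd at_ aL) aT) (RMul (RGet 4 ctr) (RGet 3 (NSub at_ ctr))))
 (Seq (Sum 14 (NSub (NAdd at_ aL) aT) (NMin aL (NSub at_ N1))
           (RMul (RGet 4 (NMin (NSub (NSub aL N1) ctr) ctr)) (RGet 3 (NSub at_ ctr))))
      (RSet 10 N0
        (RSub (RGet 1 at_)
          (RAdd (RAdd (RAdd (RAdd (RMul aVbar (RGet 2 at_)) (RMul aV (rcell 11)))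
                            (RMul aV (rcell 12)))
                      (RMul (RSub (RSub aC aVbar) (RMul (RGet 4 am) aV)) (RGet 6 ae)))
                (RAdd (RMul aV (rcell 13)) (RMul aV (rcell 14))))))))).

(** Real cell 8 starts at 0 and only a strictly larger value replaces it, so the flag is raised only
    by a positive violation. *)
Definition update : cmd :=
  If (RLe (rcell 10) (rcell 8)) Skip
     (Seq (RSet 8 N0 (rcell 10))
     (Seq (NSet 1 N0 N1) (Seq (NSet 1 N1 at_) (NSet 1 (NConst 2) am)))).

Definition search_step : cmd :=
  If (RLe (RGet 4 am) (RDiv (RSub aC aVbar) aV)) (Seq evaluate update) Skip.

Definition search : cmd :=
  Seq (RSet 8 N0 (RConst 0))
      (For 4 N1 aT (For 5 (NSub (NSub ahat at_) N1) (NSub aT at_) search_step)).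

(* [scan] leaves the characteristic vector of the optimal [S] in the natural array 2,
   on the range it visits; running it once more on the best [(t, m)] recovers [S]. *)
Definition recover : cmd :=
  If (NLe N1 (NGet 1 N0))
     (Seq (For 6 N1 (NAdd aT N1) (NSet 2 idx N0))
     (Seq (NSet 4 N0 (NGet 1 N1)) (Seq (NSet 5 N0 (NGet 1 (NConst 2))) scan)))
     Skip.

Definition separation : cmd := Seq tables (Seq search recover).

(** * Correctness: optimal violations and preserved data *)

Section Correctness.

Variables (R : realType) (T L : nat) (C Vbar V : R).
Variables (x y : 'rV[R]_T) (u : 'rV[R]_T.-1).
Hypotheses (L_gt0 : (0 < L)%N) (LT : (L + 1 <= T)%N) (V_gt0 : 0 < V).

Definition startup_net (i : nat) : R :=
  coord 1 y i - \sum_(0 <= j < minn L (i - 1)) coord 2 u (i - j).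

Definition net (i : nat) : R :=
  coord 1 y i - \sum_(0 <= j < L) coord 2 u (i - j).

Definition min_ramp (t m : nat) : R :=
  \sum_(hat L t <= k < t + m + 1) run_min net (hat L t) (k.+1 - hat L t).

(** The violation optimised over [S]: an upper bound by [violation_le], attained by
    [violation_eq]. *)
Definition max_violation (t m : nat) : R :=
  coord 1 x t -
  (Vbar * coord 1 y t + V * (\sum_(t.+1 <= i < hat L t) startup_net i)
   + V * min_ramp t m + (C - Vbar - m%:R * V) * net (t + m + 1)
   + phi L V u t).

Definition index_ok (t m : nat) : Prop :=
  [/\ (1 <= t <= T - 1)%N, (hat L t - t - 1 <= m <= T - t - 1)%N
    & m%:R <= (C - Vbar) / V].

(** In the first case of [hat], [0 < L] forces the added minimum to be positive. *)
Lemma hat_gt t : (t < hat L t)%N.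
Proof. by rewrite /hat; case: ifP; lia. Qed.

(** Only the third term depends on [S], and its factor [V] is positive, so the lower bound on the
    ramping sum turns into an upper bound on the violation. *)
Lemma violation_le t m S : in_family T L C Vbar V t m S ->
  violation L C Vbar V x y u t m S <= max_violation t m.
Proof.
move=> [_ hm _ Sin]; rewrite /violation /max_violation /rhs lerB // lerD2r lerD2r lerD2l.
rewrite ler_pM2l //; apply: ramp_sum_ge => [|i /Sin]; first by have := hat_gt t; lia.
lia.
Qed.

Lemma violation_eq t m (S : {fset nat}) : in_family T L C Vbar V t m S ->
  (forall k, (hat L t < k < t + m + 1)%N ->
     (k \in S) = (net k < run_min net (hat L t) (k - hat L t))) ->
  violation L C Vbar V x y u t m S = max_violation t m.
Proof.
move=> [_ hm _ Sin] rec; rewrite /violation /max_violation /rhs /min_ramp.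
rewrite -(ramp_sum_records _ _ rec) //; first by have := hat_gt t; lia.
by move=> i /Sin; lia.
Qed.

Definition has_input (s : state R) : Prop :=
  [/\ nmem s 0 0 = T, nmem s 0 1 = L, rmem s 0 0 = C, rmem s 0 1 = Vbar
    & rmem s 0 2 = V] /\
  [/\ rmem s 1 =1 coord 1 x, rmem s 2 =1 coord 1 y & rmem s 3 =1 coord 2 u].

Definition tabulated (s : state R) : Prop :=
  (forall i, (i <= T)%N -> rmem s 4 i = i%:R) /\
  (forall i, (0 < i <= T)%N ->
     [/\ rmem s 5 i = startup_net i, rmem s 6 i = net i
       & nmem s 7 i = hat L i]).

Definition ready (s : state R) : Prop := has_input s /\ tabulated s.

Lemma has_input_agree ns rs s s' : agree ns rs s s' -> 0%N \notin ns ->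
  all (fun a => a \notin rs) (iota 0 4) -> has_input s -> has_input s'.
Proof.
move=> [An Ar] n0 /= /and5P[r0 r1 r2 r3 _] [[iT iL iC iVb iV] [ix iy iu]].
split; first by rewrite !An ?Ar.
by split=> k; rewrite Ar.
Qed.

Lemma ready_agree ns rs s s' : agree ns rs s s' ->
  all (fun a => a \notin ns) [:: 0; 7]%N ->
  all (fun a => a \notin rs) (iota 0 7) -> ready s -> ready s'.
Proof.
move=> A hn hr [Hi [H4 H]]; split.
  apply: has_input_agree A _ _ Hi; first by case/andP: hn.
  by case/and5P: hr => /= -> -> -> -> _.
case: A => An Ar; move: hn hr => /= /and3P[_ n7 _] /and4P[_ _ _].
move=> /and5P[_ r4 r5 r6 _].
by split=> i /= hi; rewrite ?Ar // ?An //; [exact: H4 | exact: H].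
Qed.

(** * Correctness of the tables *)

Lemma number_table_ok s Q : has_input s ->
  (forall s', agree (nwrites number_table) (rwrites number_table) s s' ->
     (forall i, (i <= T)%N -> rmem s' 4 i = i%:R) -> Q s') ->
  runs T number_table s Q.
Proof.
move=> Hi HQ; apply: runs_agree.
apply: runs_seq; apply: runs_rset; set s0 := State _ _.
apply: (@runs_for _ _ _ _ _ _ _
  (fun k s' => forall i, (i < k)%N -> rmem s' 4 i = i%:R) 1 T.+1) => //.
- move=> s' A /=; have [[-> _ _ _ _] _] := has_input_agree A isT isT (Hi : has_input s0).
  by rewrite addn1.
- by rewrite subSS subn0.
- by case.
- move=> k s1 _ /andP[k1 _] kE I; apply: runs_rset => i /= ik.
  rewrite /upd /= kE; case: eqP => [->|ne]; last by apply: I; lia.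
  rewrite I; last lia.
  by rewrite natr1; congr _%:R; lia.
- move=> s' _ I A; apply: HQ => // i iT; apply: I; lia.
Qed.

(** Serves both tables, with [n k] equal to [minn L (k - 1)] or to [L]. The target array must avoid
    the input and the accumulator 7. *)
Lemma net_table_ok a hi (n : nat -> nat) s Q :
  a \notin [:: 0; 1; 2; 3; 7]%N -> has_input s ->
  (forall k s', has_input s' -> nmem s' 6 0%N = k -> neval s' hi = n k) ->
  (forall k, (k <= T)%N -> (n k <= T)%N) ->
  (forall s', agree (nwrites (net_table a hi)) (rwrites (net_table a hi)) s s' ->
     (forall i, (0 < i <= T)%N ->
        rmem s' a i = coord 1 y i - \sum_(0 <= j < n i) coord 2 u (i - j)) ->
     Q s') ->
  runs T (net_table a hi) s Q.
Proof.
move=> ha Hi hiE nT HQ; apply: runs_agree.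
have keep s' : agree (nwrites (net_table a hi)) (rwrites (net_table a hi)) s s' ->
    has_input s'.
  move=> A; apply: has_input_agree A _ _ Hi => //=.
  by move: ha; rewrite !inE !negb_or !(eq_sym a) => /and5P[-> -> -> -> _].
have a7 : (7%N == a) = false.
  by apply/negbTE; move: ha; rewrite !inE !negb_or !(eq_sym a) => /and5P[_ _ _ _].
apply: (@runs_for _ _ _ _ _ _ _ (fun k s' => forall i, (0 < i < k)%N ->
  rmem s' a i = coord 1 y i - \sum_(0 <= j < n i) coord 2 u (i - j)) 1 T.+1) => //.
- by move=> s' A /=; have [[-> _ _ _ _] _] := keep _ A; rewrite addn1.
- by rewrite subSS subn0.
- by move=> [|[]].
- move=> k s1 A1 /andP[k1 kT] kE I.
  have Hi1 := keep _ A1; apply: runs_seq.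
  apply: (@runs_sum _ _ _ _ _ _ _ 0%N (n k) (fun j => coord 2 u (k - j))).
  + move=> s' A; split=> //; apply: hiE; last by rewrite A.1.
    exact: has_input_agree A _ _ Hi1.
  + by rewrite subn0 nT.
  + by move=> j s' [An Ar] jE _ /=; rewrite An // Ar // kE jE; case: Hi1 => _ [_ _ ->].
  + move=> s2 [An Ar] E; apply: runs_rset => i /= ik.
    rewrite /upd An // kE eqxx /=; case: eqP => [->|ne].
      by rewrite E Ar //; case: Hi1 => _ [_ -> _].
    rewrite Ar ?I //; last by rewrite inE eq_sym a7.
    lia.
- by move=> s' _ I A; apply: HQ => // i iT; apply: I; lia.
Qed.

Lemma hat_table_ok s Q : has_input s ->
  (forall s', agree (nwrites hat_table) (rwrites hat_table) s s' ->
     (forall i, (0 < i <= T)%N -> nmem s' 7 i = hat L i) -> Q s') ->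
  runs T hat_table s Q.
Proof.
move=> Hi HQ; apply: runs_agree.
have keep s' : agree (nwrites hat_table) (rwrites hat_table) s s' -> has_input s'.
  by move=> A; apply: has_input_agree A _ _ Hi.
apply: (@runs_for _ _ _ _ _ _ _
  (fun k s' => forall i, (0 < i < k)%N -> nmem s' 7 i = hat L i) 1 T.+1) => //.
- by move=> s' A /=; have [[-> _ _ _ _] _] := keep _ A; rewrite addn1.
- by rewrite subSS subn0.
- by move=> [|[]].
- move=> k s1 A1 /andP[k1 kT] kE I.
  have [[_ iL _ _ _] _] := keep _ A1.
  by apply: runs_if => /= hb; apply: runs_nset => i /= ik; move: hb;
    rewrite /upd kE iL -!minnE /=; (case: eqP => [-> hb|ne _]; last by apply: I; lia);
    rewrite /hat mul2n -addnn; move: hb; case: leqP => // _ _;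
    rewrite !addn1 maxnE; lia.
- by move=> s' _ I A; apply: HQ => // i iT; apply: I; lia.
Qed.

Lemma tables_ok s Q : has_input s ->
  (forall s', agree (nwrites tables) (rwrites tables) s s' -> ready s' -> Q s') ->
  runs T tables s Q.
Proof.
move=> Hi HQ; apply: runs_agree.
apply: runs_seq; apply: number_table_ok => // s1 A1 E1.
have Hi1 : has_input s1 by apply: has_input_agree A1 _ _ Hi.
apply: runs_seq; apply: (@net_table_ok _ _ (fun k => minn L (k - 1))) => //.
- by move=> k s' [[_ iL _ _ _] _] kE; rewrite /= kE iL -minnE.
- by move=> k; lia.
move=> s2 A2 E2.
have Hi2 : has_input s2 by apply: has_input_agree A2 _ _ Hi1.
apply: runs_seq; apply: (@net_table_ok _ _ (fun=> L)) => //.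
- by move=> k s' [[_ iL _ _ _] _] kE.
- by move=> k; lia.
move=> s3 A3 E3.
have Hi3 : has_input s3 by apply: has_input_agree A3 _ _ Hi2.
apply: hat_table_ok => // s4 A4 E4 A; apply: HQ => //.
split; first exact: has_input_agree A4 _ _ Hi3.
split=> i; first by rewrite A4.2 // A3.2 // A2.2 //; apply: E1.
by move=> iT; rewrite A4.2 // A3.2 // E2 // A4.2 // E3 // E4.
Qed.
Lemma ready_hat s t : ready s -> (0 < t <= T)%N -> nmem s 7 t = hat L t.
Proof. by case=> _ [_ H] /H[]. Qed.

Lemma ready_net s i : ready s -> (0 < i <= T)%N -> rmem s 6 i = net i.
Proof. by case=> _ [_ H] /H[]. Qed.

Lemma ready_startup_net s i : ready s -> (0 < i <= T)%N -> rmem s 5 i = startup_net i.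
Proof. by case=> _ [_ H] /H[]. Qed.

(** * Evaluation of one pair [(t, m)] *)

Lemma scan_ok t m s Q : ready s -> nmem s 4 0%N = t -> nmem s 5 0%N = m ->
  (0 < t)%N -> (hat L t <= t + m + 1 <= T)%N ->
  (forall s', agree (nwrites scan) (rwrites scan) s s' ->
     rmem s' 12 0%N = min_ramp t m ->
     (forall k, nmem s' 2 k =
        if (hat L t <= k < t + m + 1)%N
        then nat_of_bool (net k < run_min net (hat L t) (k - hat L t))
        else nmem s 2 k) ->
     Q s') ->
  runs T scan s Q.
Proof.
move=> Rs tE mE t0 /andP[he eT] HQ; apply: runs_agree.
have ht := hat_gt t; set h := hat L t in he HQ ht *.
have hE s' : ready s' -> nmem s' 4 0%N = t -> neval s' ahat = h.
  by move=> Rs' E; rewrite /= E ready_hat //; lia.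
apply: runs_seq; apply: runs_rset; set s1 := State _ _.
apply: runs_seq; apply: runs_rset; set s2 := State _ _.
have Rs2 : ready s2 by [].
have v9 : rmem s2 9 0%N = net h.
  by rewrite /= {1}/upd /= {1}/upd /= tE (ready_hat Rs) ?(ready_net Rs) //; lia.
(* At [k = h] the first clause reads [run_min net h 0 = net h], the value loaded before the loop. *)
pose I k (s' : state R) := [/\ rmem s' 9 0%N = run_min net h (k - h),
  rmem s' 12 0%N = \sum_(h <= i < k) run_min net h (i.+1 - h)
  & forall i, nmem s' 2 i = if (h <= i < k)%N
      then nat_of_bool (net i < run_min net h (i - h)) else nmem s 2 i].
apply: (@runs_for _ _ _ _ _ _ _ I h (t + m + 1)) => //.
- exact: hE.
- by move=> s' A /=; rewrite !A.1 //= tE mE.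
- lia.
- by split=> [||i]; rewrite ?subnn ?big_geq //= ltnNge andbN.
- move=> k s3 A /andP[hk ke] kE [I9 I12 I2].
  have Rs3 := ready_agree A isT isT Rs2.
  have wE : rmem s3 6 k = net k by rewrite (ready_net Rs3) //; lia.
  (* Common end of both branches: [b] tells whether [k] is a strict record, and what remains is to
     add the updated minimum to the sum. *)
  have next_I (b : bool) s4 : b = (net k < run_min net h (k - h)) ->
      nmem s4 6 0%N = k ->
      rmem s4 9 0%N = (if b then net k else run_min net h (k - h)) ->
      rmem s4 12 0%N = rmem s3 12 0%N ->
      (forall i, nmem s4 2 i = upd (nmem s3) 2 k (nat_of_bool b) 2 i) ->
      runs T (RSet 12 N0 (RAdd (rcell 12) (rcell 9))) s4 (I k.+1).
    move=> bE kE4 E9 E12 E2; apply: runs_rset.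
    have step : rmem s4 9 0%N = run_min net h (k.+1 - h).
      rewrite E9 bE subSn //= subnKC // /Num.min.
      by case: ltgtP.
    split=> /=.
    + by rewrite {1}/upd /=.
    + by rewrite /upd !eqxx /= E12 I12 step big_nat_recr.
    + move=> i; rewrite E2 /upd eqxx /= ltnS.
      case: eqP => [->|ne]; first by rewrite hk leqnn bE.
      by rewrite I2 [(i <= k)%N]leq_eqVlt; case: eqP ne.
  apply: runs_seq; apply: runs_if => /=; rewrite kE I9 wE => hb.
    apply: runs_nset; rewrite [neval _ _]/= kE.
    by apply: (next_I false) => //=; rewrite ?(leNgt _ (net k)); apply/esym/negbTE; rewrite -leNgt.
  apply: runs_seq; apply: runs_rset; apply: runs_nset.
  apply: (next_I true) => //=; first by rewrite ltNge hb.
  + by rewrite /upd !eqxx /= kE wE.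
  + by rewrite kE.
- move=> s' _; rewrite (maxn_idPr he) => -[I9 I12 I2] A.
  exact: HQ.
Qed.

Lemma evaluate_ok t m s Q : ready s -> nmem s 4 0%N = t -> nmem s 5 0%N = m ->
  (0 < t)%N -> (hat L t <= t + m + 1 <= T)%N ->
  (forall s', agree (nwrites evaluate) (rwrites evaluate) s s' ->
     rmem s' 10 0%N = max_violation t m -> Q s') ->
  runs T evaluate s Q.
Proof.
move=> Rs tE mE t0 heT HQ; apply: runs_agree.
have ht := hat_gt t.
have keep ns rs s1 s2 : agree ns rs s1 s2 ->
    all (fun a => a \notin ns) [:: 0; 4; 5; 7]%N ->
    all (fun a => a \notin rs) (iota 0 7) ->
    [/\ ready s1, nmem s1 4 0%N = t & nmem s1 5 0%N = m] ->
    [/\ ready s2, nmem s2 4 0%N = t & nmem s2 5 0%N = m].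
  move=> A /= /and5P[n0 n4 n5 n7 _] hr [R1 t1 m1]; rewrite !A.1 //; split=> //.
  by apply: ready_agree A _ hr R1; rewrite /= n0 n7.
have H0 : [/\ ready s, nmem s 4 0%N = t & nmem s 5 0%N = m] by [].
apply: runs_seq.
apply: (@runs_sum _ _ _ _ _ _ _ t.+1 (hat L t) startup_net); [|lia| |].
- move=> s' A; have [R1 E1 _] := keep _ _ _ _ A isT isT H0.
  by rewrite /= E1 addn1 ready_hat //; lia.
- move=> k s' A kE hk; have [R1 _ _] := keep _ _ _ _ A isT isT H0.
  by rewrite /= kE (ready_startup_net R1) //; lia.
move=> s1 A1 E11; have H1 := keep _ _ _ _ A1 isT isT H0.
apply: runs_seq; apply: (@scan_ok t m) => //; try by case: H1.
move=> s2 A2 E12 _; have H2 := keep _ _ _ _ A2 isT isT H1.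
apply: runs_seq.
apply: (@runs_sum _ _ _ _ _ _ _ 1%N (t + L - T) (fun k => k%:R * coord 2 u (t - k))); [|lia| |].
- move=> s' A; have [[[[iT iL _ _ _] _] _] E _] := keep _ _ _ _ A isT isT H2.
  by rewrite /= E iT iL.
- move=> k s' A kE hk.
  have [[[_ [_ _ iu]] [H4 _]] E _] := keep _ _ _ _ A isT isT H2.
  by rewrite /= kE E iu H4 //; lia.
move=> s3 A3 E13; have H3 := keep _ _ _ _ A3 isT isT H2.
apply: runs_seq.
apply: (@runs_sum _ _ _ _ _ _ _ (t + L - T)%N (minn L (t - 1))
  (fun k => (minn (L - 1 - k) k)%:R * coord 2 u (t - k))); [|lia| |].
- move=> s' A; have [[[[iT iL _ _ _] _] _] E _] := keep _ _ _ _ A isT isT H3.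
  by rewrite /= E iT iL -minnE.
- move=> k s' A kE hk.
  have [[[[_ iL _ _ _] [_ _ iu]] [H4 _]] E _] := keep _ _ _ _ A isT isT H3.
  by rewrite /= kE E iu iL -minnE H4 //; lia.
move=> s4 A4 E14; have [R4 t4 m4] := keep _ _ _ _ A4 isT isT H3.
apply: runs_rset => A; apply: HQ => //=.
have [[[_ _ iC iVb iV] [ix iy _]] [H4 _]] := R4.
rewrite /upd !eqxx /= t4 m4 ix iy iC iVb iV H4 ?(ready_net R4) ?E14; try lia.
(* Each partial sum has its own array, so the frame conditions of the later pieces carry it to the
   end. *)
rewrite A4.2 // A4.2 // A4.2 // E13 A3.2 // A3.2 // E12 A2.2 // E11.
by [].
Qed.

(** * Search over all pairs [(t, m)] *)

Definition best_among (D : nat -> nat -> Prop) (s : state R) : Prop :=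
  [/\ 0 <= rmem s 8 0%N,
      forall t m, D t m -> index_ok t m -> max_violation t m <= rmem s 8 0%N
    & (nmem s 1 0 = 0%N /\ rmem s 8 0%N = 0) \/
      [/\ nmem s 1 0 = 1%N, index_ok (nmem s 1 1) (nmem s 1 2),
          0 < rmem s 8 0%N
        & rmem s 8 0%N = max_violation (nmem s 1 1) (nmem s 1 2)]].

Lemma best_among_sub (D D' : nat -> nat -> Prop) s :
  (forall t m, index_ok t m -> D' t m -> D t m) ->
  best_among D s -> best_among D' s.
Proof. by move=> sub [b0 bD b]; split=> // t m D'tm ok; apply: bD => //; apply: sub. Qed.

(** [D] collects the pairs already treated. The new pair joins it in every case: an inadmissible
    pair demands nothing, a pair that is not better obeys the current bound, and a better one raises
    the bound, which keeps the old pairs below it. *)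
Lemma search_step_ok D t m s : ready s -> best_among D s ->
  nmem s 4 0%N = t -> nmem s 5 0%N = m ->
  (1 <= t <= T - 1)%N -> (hat L t - t - 1 <= m <= T - t - 1)%N ->
  runs T search_step s
    (best_among (fun t' m' => D t' m' \/ t' = t /\ m' = m)).
Proof.
move=> Rs [b0 bD b] tE mE ht hm.
have [[[_ _ iC iVb iV] _] [H4 _]] := Rs.
have htt := hat_gt t.
have guardE : beval s (RLe (RGet 4 am) (RDiv (RSub aC aVbar) aV)) =
    (m%:R <= (C - Vbar) / V) by rewrite /= mE H4 ?iC ?iVb ?iV //; lia.
apply: runs_if; rewrite guardE => okm; last first.
  apply: runs_skip; split=> // t' m' [Dtm|[-> ->]]; first exact: bD.
  by case=> _ _; rewrite (negbTE okm).
have oktm : index_ok t m by [].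
apply: runs_seq; apply: (evaluate_ok (t := t) (m := m)) => //; try lia.
move=> s1 A E.
have best8 : rmem s1 8 0%N = rmem s 8 0%N by rewrite A.2.
apply: runs_if => /=; rewrite E best8 => le.
  apply: runs_skip; split; rewrite ?best8 //.
    by move=> t' m' [Dtm|[-> ->] //]; apply: bD.
  by rewrite !A.1.
rewrite -ltNge in le.
apply: runs_seq; apply: runs_rset; apply: runs_seq; apply: runs_nset.
apply: runs_seq; apply: runs_nset; apply: runs_nset.
have v0 := le_lt_trans b0 le.
split; rewrite /= {1}/upd /= E; first exact: ltW.
  move=> t' m' [Dtm okt|[-> -> //]]; apply: ltW; apply: le_lt_trans le; exact: bD.
right; rewrite /upd /= !A.1 //= tE mE.
by split.
Qed.

Lemma search_ok s Q : ready s -> nmem s 1 0%N = 0%N ->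
  (forall s', ready s' -> best_among (fun _ _ => True) s' -> Q s') ->
  runs T search s Q.
Proof.
move=> Rs f0 HQ; apply: runs_seq; apply: runs_rset; set s0 := State _ _.
have Rs0 : ready s0 by [].
apply: (@runs_for _ _ _ _ _ _ _
  (fun k s' => best_among (fun t _ => (t < k)%N) s') 1 T) => //.
- by move=> s' A; have [[[? _ _ _ _] _] _] := ready_agree A isT isT Rs0.
- lia.
- split; rewrite ?lexx //; last by left.
  by move=> [|t] m // _ [].
- move=> t s1 A /[dup] ht /andP[t1 tT] tE best.
  have Rs1 := ready_agree A isT isT Rs0.
  have [[[iT _ _ _ _] _] _] := Rs1.
  have htt := hat_gt t.
  (* The treated pairs form an initial segment of the lexicographic order: all earlier [t'], and for
     [t] itself the [m'] below the counter. *)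
  apply: (@runs_for _ _ _ _ _ _ _ (fun k s' =>
    best_among (fun t' m' => (t' < t)%N \/ t' = t /\ (m' < k)%N) s')
    (hat L t - t - 1) (T - t)) => //.
  + by rewrite /= tE (ready_hat Rs1) //; lia.
  + move=> s' A'; have [[[iT' _ _ _ _] _] _] := ready_agree A' isT isT Rs1.
    by rewrite /= iT' A'.1 //= tE.
  + lia.
  + apply: best_among_sub best => t' m' [_ hm' _] [//|[E]]; rewrite E in hm'; lia.
  + move=> m s2 A2 hm mE best2.
    have Rs2 := ready_agree A2 isT isT Rs1.
    apply: runs_cons.
      apply: (@search_step_ok _ t m) best2 _ _ _ _ => //; [|lia|lia].
      by rewrite A2.1.
    move=> s3; apply: best_among_sub => t' m' _ [lt|[E lt]]; first by left; left.
    by move: lt; rewrite ltnS leq_eqVlt => /orP[/eqP|lt]; [right | left; right].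
  (* Admissibility gives [m' <= T - t - 1], so every admissible pair with first component [t] has
     been treated. *)
  + move=> s2 _; apply: best_among_sub => t' m' [_ hm' _].
    rewrite ltnS leq_eqVlt => /orP[/eqP E|lt]; last by left.
    by right; rewrite E in hm' *; split=> //; lia.
- move=> s1 A; rewrite (maxn_idPr _) => [best|]; last lia.
  apply: HQ; first exact: ready_agree A isT isT Rs0.
  by apply: best_among_sub best => t m [ht _ _] _; lia.
Qed.

(** * Recovery of [S] and the final bound *)

Lemma recover_ok s Q : ready s -> best_among (fun _ _ => True) s ->
  (forall s', separated L C Vbar V x y u s' -> Q s') ->
  runs T recover s Q.
Proof.
move=> Rs [_ best out] HQ.
have bound t m S : in_family T L C Vbar V t m S ->
    violation L C Vbar V x y u t m S <= rmem s 8 0%N.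
  move=> fam; apply: le_trans (violation_le fam) _; apply: best => //.
  by case: fam.
case: out => [[f0 v0]|[f1 ok v_gt0 vE]]; last first.
  apply: runs_if => /=; rewrite f1 // => _.
  have [iT _] := Rs; have [[{}iT _ _ _ _] _] := iT.
  set t := nmem s 1 1 in ok vE *; set m := nmem s 1 2 in ok vE *.
  have [ht hm mle] := ok; have htt := hat_gt t.
  (* The scans of other pairs left marks in natural array 2. They are erased first, because the last
     scan overwrites only its own range. *)
  apply: runs_seq; apply: (@runs_for _ _ _ _ _ _ _
    (fun k s' => forall i, (0 < i < k)%N -> nmem s' 2 i = 0%N) 1 T.+1) => //.
  - by move=> s' A /=; rewrite A.1 //= iT addn1.
  - lia.
  - by move=> [|[]].
  - move=> k s1 A hk kE I; apply: runs_nset => i /= ik.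
    by rewrite /upd /= kE; case: eqP => // ne; apply: I; lia.
  move=> s1 A1; rewrite (maxn_idPr _) => [I|]; last lia.
  have Rs1 := ready_agree A1 isT isT Rs.
  apply: runs_seq; apply: runs_nset; apply: runs_seq; apply: runs_nset.
  set s2 := State _ _.
  have t2 : nmem s2 4 0%N = t by rewrite /= /upd /= A1.1.
  have m2 : nmem s2 5 0%N = m by rewrite /= /upd /= A1.1.
  have Rs2 : ready s2 by exact: Rs1.
  apply: (scan_ok Rs2 t2 m2); [lia | lia |].
  move=> s3 A3 _ S3; apply: HQ; right.
  have o1 i : nmem s3 1 i = nmem s 1 i by rewrite A3.1 // -(A1.1 1%N).
  rewrite /out_flag /out_t /out_m !o1 -/t -/m.
  (* Outside the scanned range the marks are 0, and at [\hat t] the strict test compares [net] with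
     itself and fails; what remains are the strict records. *)
  have memS k : (k \in out_S T s3) = (hat L t < k < t + m + 1)%N &&
      (net k < run_min net (hat L t) (k - hat L t)).
    rewrite !inE mem_iota S3 /=.
    have [hk|hk] := boolP (hat L t <= k < t + m + 1)%N.
      have -> : (0 < k < 1 + T)%N by lia.
      have [->|ne] := eqVneq k (hat L t).
        by rewrite subnn /= ltxx ltnn.
      have -> : (hat L t < k < t + m + 1)%N by lia.
      by case: (_ < _).
    have -> : (hat L t < k < t + m + 1)%N = false by lia.
    by case: (boolP (0 < k < 1 + T)%N) => // hk'; rewrite /upd /= I //; lia.
  have fam : in_family T L C Vbar V t m (out_S T s3).
    by split=> // k; rewrite memS => /andP[hk _]; lia.
  have E : violation L C Vbar V x y u t m (out_S T s3) = rmem s 8 0%N.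
    by rewrite vE; apply: violation_eq => // k hk; rewrite memS hk.
  by split=> //; rewrite E.
apply: runs_if => /=; rewrite f0 // => _; apply: runs_skip; apply: HQ; left.
by split=> // t m S /bound; rewrite v0.
Qed.

Lemma separation_ok :
  runs T separation (input L C Vbar V x y u) (separated L C Vbar V x y u).
Proof.
apply: runs_seq; apply: tables_ok => // s A Rs.
apply: runs_seq; apply: search_ok => //; first by rewrite A.1.
by move=> s' Rs' best; apply: recover_ok.
Qed.

End Correctness.

Unset Implicit Arguments.

Theorem proposition8 (R : realType) :
  exists P : cmd,
  forall rho : R,
  exists c : nat,
  forall (T L : nat) (C Vbar V : R) (x y : 'rV[R]_T) (u : 'rV[R]_T.-1),
    (0 < L)%N -> (L + 1 <= T)%N ->
    Vbar <= C -> 0 < V ->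
    (C - Vbar) / V = rho ->
    (forall i, 0 <= x ord0 i) ->
    (forall i, 0 <= y ord0 i) ->
    (forall i, 0 <= u ord0 i) ->
    exists (n : nat) (s : state R),
      [/\ exec P (input L C Vbar V x y u) n s,
          separated L C Vbar V x y u s
        & (n <= c * T ^ 3)%N].
Proof.
(* The deepest nesting is 3: over [t], over [m], and a sum or scan. No loop makes more than [T]
   iterations, so the cost is at most [weight separation * T.+1 ^ 3]; the factor [2 ^ 3] comes from
   [T.+1 <= 2 * T]. *)
exists separation => rho; exists (weight separation * 2 ^ 3)%N.
move=> T L C Vbar V x y u L_gt0 LT _ V_gt0 _ _ _ _.
have [n [s [e B sep]]] := separation_ok C Vbar x y u L_gt0 LT V_gt0.
exists n, s; split=> //; apply: leq_trans B _.
rewrite -mulnA leq_pmul2l // -expnMn leq_exp2r //; lia.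
Qed.
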